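(* Let $G$ be a $K_{2,3}$-minor free graph of order $n\geq 22$. Then $q(G)\leq q(F_{2,3}(n))$, with equality if and only if $G=F_{2,3}(n)$. Here, writing $n-1=3p+r$ with integers $p\ge 0$ and $0\le r<3$, $q(F_{2,3}(n))$ is the largest root of the equation $$x^3-(n+2r+3)x^2+(8r+3n+2rn-8)x+14r+4n-8rn-2r^2-4=0.$$
   Context: All graphs are finite, simple and undirected. For a graph $G$, $Q(G)=D(G)+A(G)$ is the signless Laplacian matrix ($D(G)$ the diagonal degree matrix, $A(G)$ the adjacency matrix), and $q(G)$ denotes its largest eigenvalue (the signless Laplacian spectral radius). A graph $H$ is a minor of $G$ if $H$ can be obtained from $G$ by deleting edges, contracting edges, or deleting vertices; $G$ is $H$-minor free if it has no minor isomorphic to $H$. $K_{s,t}$ is the complete bipartite graph with parts of sizes $s$ and $t$, and $K_m$ the complete graph on $m$ vertices. For graphs $G,H$ on disjoint vertex sets, $G\cup H$ is their disjoint union, $G\vee H$ is their join (disjoint union plus all edges between $V(G)$ and $V(H)$), and $k\cdot G$ is the disjoint union of $k$ copies of $G$. For $2\le s\le t$ and $n\ge s-1$, write $n-s+1=pt+r$ with $0\le r<t$, and set $F_{s,t}(n):=K_{s-1}\vee(p\cdot K_t\cup K_r)$ (where $K_0$ is the empty graph). *)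

(* Defs.v *)
From HB Require Import structures.
From mathcomp Require Import all_boot all_order all_algebra.
From mathcomp Require classical_sets.
From mathcomp Require Import reals.
Set Implicit Arguments. Unset Strict Implicit. Unset Printing Implicit Defensive.
Import Order.TTheory GRing.Theory Num.Theory.
Local Open Scope ring_scope.

Definition simple_graph (V : finType) (e : rel V) := symmetric e /\ irreflexive e.

Definition graph_iso (V W : finType) (e : rel V) (f : rel W) :=
  exists phi : V -> W, bijective phi /\ forall x y, f (phi x) (phi y) = e x y.

Definition connected_in (V : finType) (e : rel V) (S : {set V}) :=
  forall u v, u \in S -> v \in S ->
    connect [rel a b | [&& e a b, a \in S & b \in S]] u v.

Definition is_minor (V : finType) (e : rel V) (W : finType) (h : rel W) :=
  exists B : W -> {set V},
    [/\ forall x, B x != set0,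
        forall x, connected_in e (B x),
        forall x y, x != y -> [disjoint B x & B y] &
        forall x y, h x y -> exists u v, [/\ u \in B x, v \in B y & e u v]].

Definition Kst (s t : nat) : rel ('I_s + 'I_t)%type :=
  fun x y => match x, y with
             | inl _, inr _ | inr _, inl _ => true
             | _, _ => false end.

Definition minor_free (V : finType) (e : rel V) (W : finType) (h : rel W) :=
  ~ is_minor e h.

Definition signless_laplacian (R : realType) (n : nat) (e : rel 'I_n) : 'M[R]_n :=
  \matrix_(i, j) ((if i == j then #|[set k | e i k]| else 0)%:R + (e i j)%:R).

Definition q_radius (R : realType) (n : nat) (e : rel 'I_n) : R :=
  sup (fun a : R => is_true (eigenvalue (signless_laplacian R e) a)).

(* F_{s,t}(n) = K_{s-1} \/ (p K_t u K_r), n - s + 1 = p t + r, on 'I_n: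
   vertices 0..s-2 form K_{s-1}; a vertex i >= s-1 lies in block
   (i - (s-1)) / t; two vertices >= s-1 are adjacent iff they are
   distinct and in the same block. *)
Definition Fst (s t n : nat) : rel 'I_n :=
  fun i j => (i != j) &&
    [|| (i < s.-1)%N, (j < s.-1)%N |
        ((i - s.-1) %/ t == (j - s.-1) %/ t)%N].

Arguments Kst : clear implicits.
Arguments Fst : clear implicits.

(* Main.v *)
(* Write q for the root of the cubic lying above n. A positive vector x with
   Q x <= c x bounds every eigenvalue by c, so q(G) is controlled by choosing x.
   For F the exact eigenvector (constant on the hub, on the triangles and on the
   remaining block) gives q(F) = q > n.

   Two vertices of G have at most two common neighbours. If every degree is at
   most n - 4, x = deg gives Q x <= n x by counting walks of length two; if some
   vertex has degree n - 2 or n - 3, weight n there and 2 elsewhere gives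
   Q x <= n x. In both cases q(G) <= n < q.

   Otherwise G has a vertex v of degree n - 1, and the rim G - v has maximum degree
   at most 2; its cycles are triangles because a wheel with at least four spokes
   contains K_{2,3} as a minor. Give v the weight q - 5, and rim vertices the
   weight 1 minus a loss caused by vertices of rim degree 0 or 1. Then Q x <= q x
   holds at the rim, and it holds at v iff the total loss is at least that of the
   rim of F. By handshaking there is an even number of vertices of rim degree 1, and
   without them the rest of the rim splits into triangles, so the number of isolated
   rim vertices is n - 1 modulo 3; this settles the inequality. In the case of
   equality Q x = q x everywhere, which forces the rim of F. *)
Require Import Defs.
From HB Require Import structures.
From mathcomp Require Import all_boot all_order all_algebra.
From mathcomp Require boolp classical_sets.
From mathcomp Require Import reals.
From mathcomp Require Import zify ring lra.
Import Order.TTheory GRing.Theory Num.Theory.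
Local Open Scope ring_scope.

(** * Eigenvalues of Q and positive supersolutions *)

Section SpectralRadius.
Variables (R : realType) (n : nat).
Implicit Types (e f : rel 'I_n) (x : 'I_n -> R) (c a : R).

Lemma signless_laplacian_mulE e x (i : 'I_n) : irreflexive e ->
  \sum_j signless_laplacian R e i j * x j = \sum_(j | e i j) (x i + x j).
Proof.
move=> irr.
under eq_bigr => j _ do rewrite mxE mulrDl.
rewrite big_split /= (bigD1 i) //= eqxx big1 ?addr0; last first.
  by move=> j /negbTE; rewrite eq_sym => ->; rewrite mul0r.
rewrite big_split /= sumr_const; congr (_ + _).
  by rewrite mulr_natl cardsE.
rewrite [RHS]big_mkcond; apply: eq_bigr => j _.
by case: (e i j); rewrite ?mul1r ?mul0r.
Qed.

Lemma signless_laplacian_sym e i j : symmetric e ->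
  signless_laplacian R e i j = signless_laplacian R e j i.
Proof. by move=> sym; rewrite !mxE (sym i j) eq_sym; case: eqP => // ->. Qed.

Lemma signless_laplacian_ge0 e i j : 0 <= signless_laplacian R e i j.
Proof. by rewrite mxE addr_ge0 ?ler0n. Qed.

(* Pairing [Q |z| >= a |z|] with the supersolution [x] of the symmetric matrix
   [Q] gives [(c - a) <x, |z|> >= <c x - Q x, |z|> >= 0]. *)
Lemma supersolution_pairing e x c a (z : 'rV[R]_n) : simple_graph e ->
  (forall i, 0 <= x i) -> z *m signless_laplacian R e = a *: z ->
  \sum_i (c * x i - \sum_(j | e i j) (x i + x j)) * `|z 0 i|
    <= (c - a) * \sum_i x i * `|z 0 i|.
Proof.
move=> [sym irr] x0 zE.
under eq_bigr => i _ do rewrite mulrBl.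
rewrite sumrB mulrBl lerB //; first by under eq_bigr => i _ do
  rewrite -mulrA; rewrite mulr_sumr.
rewrite mulr_sumr.
under [leRHS]eq_bigr => i _ do rewrite -signless_laplacian_mulE // mulr_suml.
rewrite exchange_big /=; apply: ler_sum => j _.
have -> : a * (x j * `|z 0 j|) = x j * (a * `|z 0 j|) by ring.
under eq_bigr => i _ do rewrite mulrAC -mulrA mulrC.
rewrite [leRHS](_ : _ = x j * \sum_i `|z 0 i| * signless_laplacian R e i j).
  apply: ler_wpM2l => //.
  have /matrixP/(_ 0 j) := zE; rewrite !mxE => zEj.
  apply: (@le_trans _ _ `|a * z 0 j|).
    by rewrite normrM ler_wpM2r ?normr_ge0 // ler_norm.
  rewrite -zEj; apply: le_trans (ler_norm_sum _ _ _) _.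
  apply: ler_sum => i _; rewrite normrM.
  by rewrite (ger0_norm (signless_laplacian_ge0 _ _ _)).
by rewrite mulr_sumr; apply: eq_bigr => i _; ring.
Qed.

Lemma norm_pairing_gt0 x (z : 'rV[R]_n) : (forall i, 0 < x i) -> z != 0 ->
  0 < \sum_i x i * `|z 0 i|.
Proof.
move=> x0 z0; rewrite lt_def sumr_ge0 ?andbT; last first.
  by move=> i _; rewrite mulr_ge0 // ltW.
apply: contra z0; rewrite psumr_eq0; last first.
  by move=> i _; rewrite mulr_ge0 // ltW.
move=> /allP h; apply/eqP/rowP => i; rewrite mxE.
have /implyP/(_ isT) := h i (mem_index_enum i).
by rewrite mulf_eq0 (gt_eqF (x0 i)) normr_eq0 => /eqP.
Qed.

(** The left side of [supersolution_pairing] is nonnegative and [<x, |z|>] is positive, so [c - a]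
    cannot be negative. No sign condition on the eigenvector is involved. *)
Lemma eigenvalue_le_supersolution e x c a : simple_graph e ->
  (forall i, 0 < x i) ->
  (forall i, \sum_(j | e i j) (x i + x j) <= c * x i) ->
  eigenvalue (signless_laplacian R e) a -> a <= c.
Proof.
move=> sg x0 xc /eigenvalueP [z zE z0].
have := supersolution_pairing e x c a z sg (fun i => ltW (x0 i)) zE.
have := norm_pairing_gt0 x z x0 z0 => pos le1.
rewrite -subr_ge0 -(pmulr_lge0 _ pos); apply: le_trans le1.
by apply: sumr_ge0 => i _; rewrite mulr_ge0 // subr_ge0.
Qed.

(** For [a = c] the pairing bounds a sum of nonnegative terms by 0, so at each vertex the slack of
    [x] times [|z i|] vanishes. It remains to see that [z] has no zero entry. *)
Lemma eigenvalue_supersolution_eq e x c (v : 'I_n) : simple_graph e ->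
  (forall u, u != v -> e v u) -> (forall i, 0 < x i) ->
  (forall i, \sum_(j | e i j) (x i + x j) <= c * x i) ->
  eigenvalue (signless_laplacian R e) c ->
  forall i, \sum_(j | e i j) (x i + x j) = c * x i.
Proof.
move=> sg hub x0 xc /eigenvalueP [z zE z0].
have x0' i : 0 <= x i by exact: ltW.
have term0 (y : 'I_n -> R) : (forall i, 0 <= y i) ->
    (forall i, \sum_(j | e i j) (y i + y j) <= c * y i) ->
    forall i, (c * y i - \sum_(j | e i j) (y i + y j)) * `|z 0 i| = 0.
  move=> y0 yc.
  have := supersolution_pairing e y c c z sg y0 zE.
  rewrite subrr mul0r => le0 i.
  have nn k : true -> 0 <= (c * y k - \sum_(j | e k j) (y k + y j)) * `|z 0 k|.
    by move=> _; rewrite mulr_ge0 // subr_ge0.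
  have /eqP : \sum_k (c * y k - \sum_(j | e k j) (y k + y j)) * `|z 0 k| = 0.
    by apply/eqP; rewrite eq_le le0 sumr_ge0.
  rewrite psumr_eq0 // => /allP /(_ i (mem_index_enum i)) /implyP /(_ isT).
  by move/eqP.
have [sym irr] := sg.
(* [|z|] is itself an eigenvector, and it cannot vanish anywhere because of the
   universal vertex. *)
have absz k : \sum_i `|z 0 i| * signless_laplacian R e i k = c * `|z 0 k|.
  have nn i : true -> 0 <= x i * (\sum_j `|z 0 j| * signless_laplacian R e j i
      - c * `|z 0 i|).
    move=> _; rewrite mulr_ge0 // subr_ge0.
    have /matrixP/(_ 0 i) := zE; rewrite !mxE => zEi.
    apply: (@le_trans _ _ `|c * z 0 i|).
      by rewrite normrM ler_wpM2r ?normr_ge0 // ler_norm.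
    rewrite -zEi; apply: le_trans (ler_norm_sum _ _ _) _.
    apply: ler_sum => j _; rewrite normrM.
    by rewrite (ger0_norm (signless_laplacian_ge0 _ _ _)).
  (* Moving [Q] to the other side of the pairing turns this sum into the slack of [x] paired with
     [|z|], up to sign, and that is 0 by [term0]. *)
  have /eqP : \sum_i x i * (\sum_j `|z 0 j| * signless_laplacian R e j i
      - c * `|z 0 i|) = 0.
    have s0 := term0 x x0' xc.
    have : \sum_i (c * x i - \sum_(j | e i j) (x i + x j)) * `|z 0 i| = 0.
      by rewrite big1.
    under eq_bigr => i _ do rewrite mulrBl -signless_laplacian_mulE // mulr_suml.
    rewrite sumrB exchange_big /= => /eqP; rewrite subr_eq0 => /eqP E.
    under eq_bigr => i _ do rewrite mulrBr.
    rewrite sumrB [X in _ - X](_ : _ = \sum_i c * x i * `|z 0 i|); last first.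
      by apply: eq_bigr => i _; ring.
    rewrite E; apply/eqP; rewrite subr_eq0; apply/eqP; apply: eq_bigr => i _.
    rewrite mulr_sumr; apply: eq_bigr => j _.
    by ring.
  rewrite psumr_eq0 // => /allP /(_ k (mem_index_enum k)) /implyP /(_ isT).
  by rewrite mulf_eq0 (gt_eqF (x0 k)) /= subr_eq0 => /eqP.
(* A zero at [k] makes the nonnegative sum in [absz k] vanish, so zeros spread to neighbours. *)
have nbr0 k : z 0 k = 0 -> forall j, e k j -> z 0 j = 0.
  move=> zk j ekj; have := absz k; rewrite zk normr0 mulr0 => /eqP.
  rewrite psumr_eq0; last first.
    by move=> i _; rewrite mulr_ge0 ?signless_laplacian_ge0.
  move=> /allP /(_ j (mem_index_enum j)) /implyP /(_ isT).
  rewrite mulf_eq0 normr_eq0 => /orP [/eqP //|].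
  by rewrite mxE sym ekj -natrD pnatr_eq0 addn1.
have znz k : z 0 k != 0.
  apply: contra z0 => /eqP zk.
  have zv : z 0 v = 0.
    have [<- //|kv] := eqVneq k v.
    by apply: (nbr0 k zk); rewrite sym hub.
  apply/eqP/rowP => i; rewrite mxE.
  have [-> //|iv] := eqVneq i v.
  by apply: (nbr0 v zv); rewrite hub.
move=> i; have /eqP := term0 x x0' xc i.
by rewrite mulf_eq0 normr_eq0 (negbTE (znz i)) orbF subr_eq0 => /eqP.
Qed.

Lemma q_radius_le e c : 0 <= c ->
  (forall a, eigenvalue (signless_laplacian R e) a -> a <= c) ->
  q_radius R e <= c.
Proof.
move=> c0 h; rewrite /q_radius.
set E := (fun a : R => _).
have [[a Ea]|nE] := boolp.pselect (classical_sets.nonempty E).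
  apply: ge_sup; first by exists a.
  by move=> b /h.
(* A set without supremum gets the default value 0; this is where [0 <= c] enters. *)
by rewrite sup_out // => -[].
Qed.

Lemma q_radius_ge e c a : (forall b, eigenvalue (signless_laplacian R e) b -> b <= c) ->
  eigenvalue (signless_laplacian R e) a -> a <= q_radius R e.
Proof.
move=> h Ea; rewrite /q_radius; apply: (@ub_le_sup _ (fun a : R => _)) => //.
by exists c => b /h.
Qed.

(* If the supremum were not attained there would be arbitrarily many roots of
   the characteristic polynomial. *)
Lemma q_radius_eigenvalue e c : (forall b, eigenvalue (signless_laplacian R e) b -> b <= c) ->
  q_radius R e != 0 -> eigenvalue (signless_laplacian R e) (q_radius R e).
Proof.
move=> h q0; rewrite /q_radius; set E := (fun a : R => _).
have hs : classical_sets.has_sup E.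
  have [//|nhs] := boolp.pselect (classical_sets.has_sup E).
  by move: q0; rewrite /q_radius sup_out ?eqxx.
have [//|nE] := boolP (eigenvalue (signless_laplacian R e) (sup E)).
suff many k : exists s : seq R, [/\ uniq s, size s = k,
    all (root (char_poly (signless_laplacian R e))) s & all (fun a => a < sup E) s].
  have [s [us ss rs _]] := many (size (char_poly (signless_laplacian R e))).
  have := max_poly_roots (monic_neq0 (char_poly_monic _)) rs us.
  by rewrite ss ltnn.
elim: k => [|k [s [us ss rs ls]]]; first by exists [::].
(* An eigenvalue above [m] is new to the list, and the supremum supplies one. *)
have [m mE ms] : exists2 m, m < sup E & all (fun a => a <= m) s.
  elim: s {us ss rs} ls => [|a s IH] /=.
    by move=> _; exists (sup E - 1) => //; rewrite ltrBlDr ltrDl.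
  move=> /andP [asup /IH [m mE ms]]; exists (Num.max a m).
    by rewrite gt_max asup.
  rewrite le_max lexx /=; apply: sub_all ms => b bm.
  by rewrite le_max bm orbT.
have [b Eb] := sup_adherent (eps := sup E - m) ltac:(by rewrite subr_gt0) hs.
rewrite opprB addrC subrK => mb.
exists (b :: s); split=> /=.
- rewrite us andbT; apply/negP => bs.
  by have := allP ms b bs; rewrite leNgt mb.
- by rewrite ss.
- by rewrite rs andbT -eigenvalue_root_char.
- rewrite ls andbT lt_neqAle ub_le_sup ?andbT //; last by case: hs.
  by apply: contra nE => /eqP <-.
Qed.

(** A positive eigenvector is its own supersolution, so its eigenvalue bounds all others. *)
Lemma q_radius_eigenvector e x c : (0 < n)%N -> simple_graph e -> 0 <= c ->
  (forall i, 0 < x i) ->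
  (forall i, \sum_(j | e i j) (x i + x j) = c * x i) -> q_radius R e = c.
Proof.
move=> n0 sg c0 x0 xc.
have le1 a := eigenvalue_le_supersolution e x c a sg x0
  (fun i => ltac:(by rewrite xc)).
apply: le_anti; rewrite q_radius_le //=.
apply: (q_radius_ge e c) => //; apply/eigenvalueP; exists (\row_i x i).
  apply/rowP => i; rewrite !mxE -xc -signless_laplacian_mulE; last by case: sg.
  apply: eq_bigr => j _; rewrite [X in X * _ = _]mxE mulrC.
  by rewrite signless_laplacian_sym //; case: sg.
apply/eqP => /rowP /(_ (Ordinal n0)); rewrite !mxE => /eqP.
by rewrite (gt_eqF (x0 _)).
Qed.

Lemma eigenvalue_graph_iso e f a : graph_iso e f ->
  eigenvalue (signless_laplacian R f) a -> eigenvalue (signless_laplacian R e) a.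
Proof.
move=> [phi [bij phiE]] /eigenvalueP [z zE z0].
have degE i : #|[set k | f (phi i) k]| = #|[set k | e i k]|.
  rewrite -[RHS](card_imset _ (bij_inj bij)); apply: eq_card => k.
  have [psi psiK phiK] := bij.
  rewrite inE -[k]phiK phiE; apply/idP/imsetP => [h|[j]].
    by exists (psi k); rewrite ?inE.
  by rewrite inE => h /(bij_inj bij) ->.
apply/eigenvalueP; exists (\row_i z 0 (phi i)).
  apply/rowP => i; rewrite !mxE.
  have /rowP /(_ (phi i)) := zE; rewrite !mxE => <-.
  rewrite [RHS](reindex phi) /=; last exact: onW_bij.
  apply: eq_bigr => j _; rewrite !mxE phiE degE.
  by rewrite (inj_eq (bij_inj bij)).
apply: contra z0 => /eqP /rowP h; apply/eqP/rowP => i; rewrite mxE.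
have [psi psiK phiK] := bij.
by have := h (psi i); rewrite !mxE phiK.
Qed.

Lemma graph_iso_sym e f : graph_iso e f -> graph_iso f e.
Proof.
move=> [phi [[psi psiK phiK] phiE]]; exists psi; split; first by exists phi.
by move=> i j; rewrite -phiE !phiK.
Qed.

Lemma q_radius_graph_iso e f : graph_iso e f -> q_radius R e = q_radius R f.
Proof.
move=> ef; rewrite /q_radius; congr (sup _).
apply: boolp.funext => a; apply: boolp.propext; split.
  by apply: eigenvalue_graph_iso; apply: graph_iso_sym.
exact: eigenvalue_graph_iso.
Qed.

End SpectralRadius.

(** * K_{2,3} minors, handshaking, and 2-regular rims *)

Section GraphLemmas.
Local Open Scope nat_scope.
Variable V : finType.
Implicit Types (e g : rel V) (S T : {set V}) (u v w x y : V).

(** The branch sets are [{u}] and [S] on the side of size two, and the singletons [a], [b], [c] on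
    the other. *)
Lemma K23_minor e u S a b c : symmetric e -> u \notin S -> S != set0 ->
  connected_in e S -> uniq [:: a; b; c] ->
  all (fun x => [&& x != u, x \notin S, e u x & [exists w in S, e w x]]) [:: a; b; c] ->
  is_minor e (Kst 2 3).
Proof.
move=> sym uS S0 cS uabc /all_tnthP aP.
have {}aP (k : 'I_3) := aP k.
pose t : 3.-tuple V := [tuple a; b; c].
have tinj : injective (tnth t) by apply/tuple_uniqP.
have {}aP k : [&& tnth t k != u, tnth t k \notin S, e u (tnth t k) &
   [exists w in S, e w (tnth t k)]] by exact: aP.
exists (fun x : 'I_2 + 'I_3 => match x with
   | inl i => if i == ord0 then [set u] else S
   | inr k => [set tnth t k] end).
have conn1 x : connected_in e [set x].
  by move=> y z /set1P -> /set1P ->; apply: connect0.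
split.
- move=> [i|k]; last by rewrite -card_gt0 cards1.
  by case: ifP => // _; rewrite -card_gt0 cards1.
- by move=> [i|k] //; case: ifP.
- move=> [i|k] [j|l] ne.
  + have {}ne : i != j by apply: contra ne => /eqP ->.
    case: (eqVneq i ord0) ne => [->|i0] ne.
      by rewrite eq_sym (negbTE ne) disjoints1.
    case: (eqVneq j ord0) ne => [->|j0] ne; first by rewrite disjoint_sym disjoints1.
    by case/negP: ne; apply/eqP/val_inj; case: i i0 => [[|[|[]]]] //; case: j j0 => [[|[|[]]]].
  + have /and4P [h1 h2 _ _] := aP l.
    by rewrite disjoint_sym disjoints1; case: ifP => _ //; rewrite inE.
  + have /and4P [h1 h2 _ _] := aP k.
    by rewrite disjoints1; case: ifP => _ //; rewrite inE.
  + rewrite disjoints1 inE; apply: contra ne => /eqP /tinj ->.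
    exact: eqxx.
- have main (i : 'I_2) (k : 'I_3) : exists x y, [/\ x \in if i == ord0 then [set u] else S,
     y \in [set tnth t k] & e x y].
    have /and4P [_ _ h1 /exists_inP [w wS ew]] := aP k.
    case: ifP => _; first by exists u, (tnth t k); rewrite !set11.
    by exists w, (tnth t k); rewrite set11.
  move=> [i|k] [j|l]; rewrite /Kst // => _.
  have [x [y [h1 h2 h3]]] := main j k.
  by exists y, x; split=> //; rewrite sym.
Qed.

(** Three common neighbours would give a [K23_minor] with [S = {v}]. *)
Lemma codegree_le2 e u v : simple_graph e -> minor_free e (Kst 2 3) -> u != v ->
  #|[set x | e u x && e v x]| <= 2.
Proof.
move=> [sym irr] mf uv; rewrite leqNgt; apply/negP => /card_gt2P.
move=> [a [b [c [[]]]]]; rewrite !inE.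
move=> /andP [ua va] /andP [ub vb] /andP [uc vc] [ab bc ca]; apply: mf.
have ne x y : e x y -> y != x by apply: contraTneq => ->; rewrite irr.
apply: (K23_minor e u [set v] a b c) => //.
- by rewrite inE.
- by rewrite -card_gt0 cards1.
- by move=> x y /set1P -> /set1P ->; apply: connect0.
- by rewrite /= !inE negb_or ab bc eq_sym ca.
- have ex x : e v x -> [exists w in [set v], e w x].
    by move=> vx; apply/exists_inP; exists v; rewrite ?set11.
  by rewrite /= !inE !ne // ua ub uc !ex.
Qed.

(** Ordering the vertices by [enum_rank] splits the ordered adjacent pairs into two halves, which
    symmetry makes equal. *)
Lemma handshake e S : symmetric e -> irreflexive e ->
  ~~ odd (\sum_(x in S) #|[set y in S | e x y]|).
Proof.
move=> sym irr.
pose F x y : nat := [&& x \in S, y \in S & e x y].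
have -> : \sum_(x in S) #|[set y in S | e x y]| = \sum_x \sum_y F x y.
  rewrite big_mkcond; apply: eq_bigr => x _; rewrite /F; case: (x \in S).
    rewrite -sum1_card big_mkcond; apply: eq_bigr => y _.
    by rewrite inE; case: (_ && _).
  by rewrite big1.
have -> : \sum_x \sum_y F x y
   = \sum_x \sum_(y | enum_rank x < enum_rank y) F x y
   + \sum_x \sum_(y | enum_rank y < enum_rank x) F x y.
  rewrite -big_split; apply: eq_bigr => x _ /=.
  rewrite (bigD1 x) //= [F x x]/F irr !andbF add0n.
  rewrite (bigID (fun y => enum_rank x < enum_rank y)) /=.
  congr (_ + _); apply: eq_bigl => y; have [->|yx] /= := eqVneq y x; rewrite ?ltnn //.
  rewrite -leqNgt leq_eqVlt.
  by have -> : (enum_rank y == enum_rank x :> nat) = false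
    by rewrite (inj_eq val_inj) (inj_eq enum_rank_inj) (negbTE yx).
rewrite [X in _ + X](_ : _ = \sum_x \sum_(y | enum_rank x < enum_rank y) F x y).
  by rewrite addnn odd_double.
rewrite (exchange_big_dep predT) //=; apply: eq_bigr => x _; apply: eq_bigr => y _.
by rewrite /F sym andbCA.
Qed.

Lemma path_connected_in e x p : symmetric e -> path e x p ->
  connected_in e [set y in x :: p].
Proof.
move=> sym pth; set S := [set y in x :: p].
pose r := [rel a b | [&& e a b, a \in S & b \in S]].
have rsym : connect_sym r.
  apply: sym_connect_sym => a b /=; rewrite sym.
  by case: (e b a) => //=; rewrite andbC.
have pr : path r x p.
  have pS : all [in S] (x :: p) by apply/allP => y yp /=; rewrite inE.
  apply: (sub_in_path _ pS pth) => a b aS bS /= ->.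
  by rewrite aS bS.
move=> a b; rewrite !inE => ain bin; apply: (connect_trans (y := x)).
  by rewrite -/r rsym; apply: (path_connect pr).
exact: (path_connect pr).
Qed.

(** The deletion of [v] is encoded by isolating it, so that the vertex type does not change. *)
Definition rim_rel e v : rel V := fun x y => [&& e x y, x != v & y != v].

(* Deleting [u] from its rim component leaves [a] and [b] as the only vertices
   of odd degree, so some path of the rim minus [u] joins them; its interior,
   [u], and the three vertices [a], [b], [v] form the minor. *)
Lemma rim_nbrs_adjacent e v T u a b : simple_graph e -> minor_free e (Kst 2 3) ->
  (forall x, x != v -> e v x) ->
  (forall x, x \in T -> #|[set y | rim_rel e v x y]| = 2) ->
  (forall x y, x \in T -> rim_rel e v x y -> y \in T) ->
  u \in T -> rim_rel e v u a -> rim_rel e v u b -> a != b -> rim_rel e v a b.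
Proof.
move=> [sym irr] mf hub deg2 clos uT gua gub ab.
set g := rim_rel e v in deg2 clos gua gub *.
have gsym : symmetric g by move=> x y; rewrite /g /rim_rel sym; case: (e y x); rewrite //= andbC.
have girr : irreflexive g by move=> x; rewrite /g /rim_rel irr.
have [//|nab] := boolP (g a b); case: mf.
have gne x y : g x y -> x != y by apply: contraTneq => ->; rewrite girr.
pose k : rel V := [rel x y | [&& g x y, x != u & y != u]].
have ksym : symmetric k by move=> x y; rewrite /k /= gsym; case: (g y x); rewrite //= andbC.
have kirr : irreflexive k by move=> x; rewrite /k /= girr.
have Nu : [set y | g u y] = [set a; b].
  apply/esym/eqP; rewrite eqEcard cards2 ab deg2 // leqnn andbT.
  by apply/subsetP => y; rewrite !inE => /orP [] /eqP ->.
have au : a != u by rewrite eq_sym gne.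
have bu : b != u by rewrite eq_sym gne.
pose C := [set x | connect k a x].
have aT : a \in T by apply: clos gua.
have Cclos x y : x \in C -> k x y -> y \in C.
  by rewrite !inE => ax xy; apply: connect_trans ax (connect1 xy).
have CT x : x \in C -> x \in T /\ x != u.
  rewrite inE => /connectP [p pth ->] {x}.
  elim: p (a) aT au pth => [|y p IH] x xT xu //=.
  move=> /andP [/and3P [gxy _ yu]] pth; apply: IH => //.
  exact: clos gxy.
(* Otherwise [a] would have degree 1 in [C] and every other vertex of [C] degree 2, contradicting
   [handshake]. *)
have bC : b \in C.
  have [//|bC] := boolP (b \in C).
  have := handshake k C ksym kirr.
  have aC : a \in C by rewrite inE connect0.
  have nbE x : x \in C -> [set y in C | k x y] = [set y | g x y] :\ u.
    move=> xC; have [xT xu] := CT _ xC.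
    apply/setP => y; rewrite [LHS]in_set in_setD1 [y \in [set y | g x y]]in_set.
    apply/andP/andP => [[yC /and3P [gxy _ yu]]|[yu gxy]]; first by split.
    have kxy : k x y by rewrite /k /= gxy xu.
    by split=> //; apply: Cclos kxy.
  rewrite (bigD1 a) //= nbE //.
  have -> : #|[set y | g a y] :\ u| = 1.
    by have := cardsD1 u [set y | g a y]; rewrite deg2 // inE gsym gua => -[].
  rewrite (eq_bigr (fun=> 2)); last first.
    move=> x /andP [xC xa]; rewrite nbE // -[RHS](deg2 x); last by case: (CT _ xC).
    rewrite [RHS](cardsD1 u) inE; suff -> : g x u = false by [].
    apply/negP; rewrite gsym => gux.
    have : x \in [set y | g u y] by rewrite inE.
    rewrite Nu !inE (negbTE xa) /= => /eqP xb.
    by rewrite xb (negbTE bC) in xC.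
  by rewrite sum_nat_const muln2 addSn add0n /= odd_double.
move: bC; rewrite inE => /connectP [p0 pth0 bE].
(* Without repetitions, [a] and [b] stay off the interior of the path, which is to be a branch
   set. *)
case/shortenP: pth0 bE => p pth up _ bE {p0}.
case/lastP: p bE pth up => [/= bE|p c]; first by rewrite bE eqxx in ab.
rewrite last_rcons => <- {c}.
rewrite rcons_path => /andP [pth klast] up.
case: p pth klast up => [_ /= /and3P [gab]|y p /= /andP [kay pth] klast up].
  by rewrite gab in nab.
have pk z : z \in y :: p -> (z != u) && (z != v).
  move=> zp; have pth' : path k a (y :: p) by rewrite /= kay.
  have zi : index z (y :: p) < size (y :: p) by rewrite index_mem.
  have := pathP a pth' _ zi; rewrite nth_index //.
  by case/and3P => /and3P [_ _ ->] _ ->.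
have exy (x z : V) : k x z -> e x z by case/and3P => /and3P [].
have av : a != v by case/and3P: gua.
have bv : b != v by case/and3P: gub.
have uv : u != v by case/and3P: gua.
have [aP bP] : a \notin y :: p /\ b \notin y :: p.
  move: up; rewrite -cons_uniq -!rcons_cons rcons_uniq cons_uniq in_cons negb_or.
  by move=> /andP [/andP [_ ->] /andP [-> _]].
apply: (K23_minor e u [set z in y :: p] a b v) => //.
- by rewrite inE; apply/negP => /pk; rewrite eqxx.
- by apply/set0Pn; exists y; rewrite inE mem_head.
- apply: path_connected_in => //; apply: sub_path pth => x z; exact: exy.
- by rewrite /= !inE negb_or ab av bv.
- have vP : v \notin [set z in y :: p].
    by rewrite inE; apply/negP => /pk; rewrite eqxx andbF.
  have ex x z : z \in y :: p -> e z x -> [exists w in [set z in y :: p], e w x].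
    by move=> zp ezx; apply/exists_inP; exists z; rewrite ?inE.
  rewrite [all _ _]/= andbT; apply/and3P; split; apply/and4P; split=> //.
  + by rewrite in_set.
  + by case/and3P: gua.
  + by apply: (ex _ y); rewrite ?mem_head // sym exy.
  + by rewrite in_set.
  + by case/and3P: gub.
  + by apply: (ex _ (last y p)); rewrite ?mem_last // exy.
  + by rewrite eq_sym.
  + by rewrite sym hub.
  + have /andP [_ yv] := pk y (mem_head _ _).
    by apply: (ex _ y); rewrite ?mem_head // sym hub.
Qed.

(** Each vertex and its two neighbours form a whole component. Listing one triangle after another
    turns adjacency into equality of quotients by 3, the block condition in [Fst]. *)
Lemma triangle_listing g T : symmetric g -> irreflexive g ->
  (forall x, x \in T -> #|[set y | g x y]| = 2) ->
  (forall x y, x \in T -> g x y -> y \in T) ->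
  (forall x a b, x \in T -> g x a -> g x b -> a != b -> g a b) ->
  exists s : seq V, [/\ uniq s, s =i T, 3 %| size s &
    forall x0 i j, i < size s -> j < size s ->
      g (nth x0 s i) (nth x0 s j) = (i != j) && (i %/ 3 == j %/ 3)].
Proof.
move=> gsym girr; have [m] := ubnP #|T|; elim: m T => // m IH T cT deg2 clos tri.
have [->|[a aT]] := set_0Vmem T.
  by exists [::]; split=> //= x; rewrite in_set0.
have /eqP/cards2P [b [c [bc Na]]] := deg2 a aT.
have gab : g a b by have /setP /(_ b) := Na; rewrite !inE eqxx => ->.
have gac : g a c by have /setP /(_ c) := Na; rewrite !inE eqxx orbT => ->.
have gbc : g b c by apply: (tri a).
have gne x y : g x y -> x != y by apply: contraTneq => ->; rewrite girr.
have bT := clos _ _ aT gab; have cT' := clos _ _ aT gac.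
have nbr x y z : x \in T -> y != z -> g x y -> g x z -> [set w | g x w] = [set y; z].
  move=> xT yz xy xz; apply/esym/eqP; rewrite eqEcard cards2 yz deg2 // leqnn andbT.
  by apply/subsetP => w; rewrite !inE => /orP [] /eqP ->.
have ga x : g a x = (x == b) || (x == c) by have /setP /(_ x) := Na; rewrite !inE.
have gb x : g b x = (x == a) || (x == c).
  have /setP /(_ x) := nbr b a c bT (gne _ _ gac) ltac:(by rewrite gsym) gbc.
  by rewrite !inE.
have gc x : g c x = (x == a) || (x == b).
  have /setP /(_ x) := nbr c a b cT' (gne _ _ gab) ltac:(by rewrite gsym) ltac:(by rewrite gsym).
  by rewrite !inE.
have abc : [&& a != b, a != c & b != c] by rewrite !gne.
case/and3P: abc => nab nac nbc.
pose S := [set a; b; c].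
have ST : S \subset T by apply/subsetP => x; rewrite !inE => /orP [/orP []|] /eqP ->.
have cS : #|S| = 3.
  by rewrite /S setUC !cardsU1 cards1 !inE negb_or ![c == _]eq_sym nac nbc nab.
have TD x : (x \in T :\: S) = [&& x != a, x != b, x != c & x \in T].
  by rewrite !inE !negb_or -!andbA.
have notS x y : x \in T :\: S -> g x y -> y \notin S.
  rewrite TD => /and4P [xa xb xc xT] gxy; apply/negP; rewrite !inE.
  move=> /orP [/orP []|] /eqP yE; move: gxy; rewrite yE gsym ?ga ?gb ?gc.
  - by rewrite (negbTE xb) (negbTE xc).
  - by rewrite (negbTE xa) (negbTE xc).
  - by rewrite (negbTE xa) (negbTE xb).
have [||||s [us sT s3 sP]] := IH (T :\: S).
- have := subset_leq_card ST; rewrite cardsD (setIidPr ST) cS.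
  by move: cT; lia.
- by move=> x; rewrite inE => /andP [_ /deg2].
- move=> x y xTS gxy; rewrite inE (notS x) //=.
  by move: xTS; rewrite inE => /andP [_ xT]; apply: clos gxy.
- by move=> x y z; rewrite inE => /andP [_]; apply: tri.
have sN x : x \in s -> [/\ x != a, x != b, x != c & x \in T].
  by rewrite sT TD => /and4P [].
have sg y x : y \in S -> x \in s -> g y x = false.
  move=> yS xs; apply/negP; rewrite gsym => /notS; rewrite -sT xs => /(_ isT).
  by rewrite yS.
exists (a :: b :: c :: s); split.
- rewrite /= us !inE !negb_or nab nac nbc /= andbT.
  by apply/and3P; split; apply/negP => /sN []; rewrite eqxx.
- move=> x; rewrite !inE sT TD.
  case: eqVneq => [->|xa] //=; case: eqVneq => [->|xb] //=.
  by case: eqVneq => [->|xc].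
- by rewrite [size _]/= -[(size s).+3]addn3 dvdn_addl.
- have aS : a \in S by rewrite !inE eqxx.
  have bS : b \in S by rewrite !inE eqxx orbT.
  have cS' : c \in S by rewrite !inE eqxx orbT.
  have gba : g b a by rewrite gsym.
  have gca : g c a by rewrite gsym.
  have gcb : g c b by rewrite gsym.
  have q3 k : k.+3 %/ 3 = (k %/ 3).+1 by rewrite -[k.+3]addn3 divnDr // addn1.
  have [d0 d1 d2] : [/\ 0 %/ 3 = 0, 1 %/ 3 = 0 & 2 %/ 3 = 0] by [].
  have mn x0 k : k < size s -> nth x0 s k \in s by exact: mem_nth.
  move=> x0 [|[|[|i]]] [|[|[|j]]] /=; rewrite ?girr ?gab ?gac ?gbc ?gba ?gca ?gcb ?q3 //
    ?(d0, d1, d2) // => hi hj.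
  + by rewrite sg ?mn.
  + by rewrite sg ?mn.
  + by rewrite sg ?mn.
  + by rewrite gsym sg ?mn.
  + by rewrite gsym sg ?mn.
  + by rewrite gsym sg ?mn.
  + by rewrite sP.
Qed.

End GraphLemmas.

(** * Graphs without a vertex of degree n - 1 *)

Section SmallMaximumDegree.
Variable n : nat.
Implicit Types (e : rel 'I_n) (u v : 'I_n).

(** Integer weights reduce the row inequalities to arithmetic in [nat]. *)
Lemma eigenvalue_le_nat_supersolution (R : realType) e (w : 'I_n -> nat) (m : nat) (a : R) :
  simple_graph e -> (forall i, 0 < w i)%N ->
  (forall i, \sum_(j | e i j) (w i + w j) <= m * w i)%N ->
  eigenvalue (signless_laplacian R e) a -> a <= m%:R.
Proof.
move=> sg w0 wm; apply: (eigenvalue_le_supersolution R n e (fun i => (w i)%:R)) => // i.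
  by rewrite ltr0n.
under eq_bigr => j _ do rewrite -natrD.
by rewrite -natr_sum -natrM ler_nat.
Qed.

Local Open Scope nat_scope.

(** The sum counts walks of length two from [i]: those returning to [i] number its degree, and at
    most two end at each other vertex. *)
Lemma sum_nbr_degree_le e i : simple_graph e ->
  (forall u v, u != v -> #|[set x | e u x && e v x]| <= 2) ->
  \sum_(j | e i j) #|[set k | e j k]| <= #|[set k | e i k]| + 2 * n.-1.
Proof.
move=> [sym irr] codeg.
rewrite (eq_bigr (fun j => \sum_k e j k)); last first.
  by move=> j _; rewrite -sum1_card big_mkcond; apply: eq_bigr => k _; rewrite inE; case: (e j k).
rewrite exchange_big /= (eq_bigr (fun k => #|[set x | e i x && e k x]|)); last first.
  move=> k _; rewrite -sum1_card big_mkcond [RHS]big_mkcond; apply: eq_bigr => x _.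
  by rewrite inE (sym x k); case: (e i x); case: (e k x).
rewrite (bigD1 i) //=; apply: leq_add.
  by apply: subset_leq_card; apply/subsetP => x; rewrite !inE andbb.
apply: (@leq_trans (\sum_(k < n | k != i) 2)).
  by apply: leq_sum => k ki; apply: codeg; rewrite eq_sym.
by rewrite sum_nat_const cardC1 card_ord mulnC.
Qed.

Lemma eigenvalue_le_order_sparse (R : realType) e (a : R) : simple_graph e ->
  10 <= n -> (forall u v, u != v -> #|[set x | e u x && e v x]| <= 2) ->
  (forall u, #|[set k | e u k]| <= n - 4) ->
  eigenvalue (signless_laplacian R e) a -> (a <= n%:R)%R.
Proof.
move=> sg n10 codeg degn; have [sym irr] := sg.
pose d u := #|[set k | e u k]|.
(* The maximum with 1 only keeps the weight positive at isolated vertices. *)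
apply: (eigenvalue_le_nat_supersolution R e (fun i => maxn 1 (d i))) => // i.
  by rewrite leq_max.
have dpos j : e i j -> 0 < d j.
  by move=> eij; apply/card_gt0P; exists i; rewrite inE sym.
have [d0|di] := posnP (d i).
  rewrite big_pred0 // => j; apply/negP => eij.
  have /card0_eq /(_ j) := d0; by rewrite !inE eij.
rewrite (eq_bigr (fun j => d i + d j)); last first.
  by move=> j /dpos dj; rewrite (maxn_idPr di) (maxn_idPr dj).
rewrite (maxn_idPr di) big_split /= sum_nat_const.
have dE : #|e i| = d i by rewrite /d cardsE.
rewrite dE.
have s1 : \sum_(j | e i j) d j <= d i + 2 * n.-1 by apply: sum_nbr_degree_le.
have s2 : \sum_(j | e i j) d j <= d i * (n - 4).
  rewrite -dE -sum_nat_const; apply: leq_sum => j _; exact: degn.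
have dn : d i <= n - 4 by exact: degn.
(* For d <= 4 the degree bound n - 4 at the neighbours suffices. Otherwise the walk count requires
   d^2 + d + 2(n - 1) <= n d; this is convex in d and holds at d = 5 and d = n - 4 once n >= 10. *)
have [d4|d5] := leqP (d i) 4.
  have -> : n * d i = 4 * d i + d i * (n - 4) by rewrite mulnBr mulnC; nia.
  by rewrite leq_add // leq_mul2r d4 orbT.
have [t nE] : exists t, n = d i + 4 + t by exists (n - 4 - d i); lia.
have arith D : 10 <= D + 4 + t -> 4 < D -> D * D + (D + 2 * (D + 4 + t).-1) <= (D + 4 + t) * D by nia.
by apply: leq_trans (leq_add (leqnn _) s1) _; have := arith (d i); rewrite -nE; apply.
Qed.

(* A vertex of degree [n - 1 - k] gets weight [n] and all the others weight 2. *)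
Lemma eigenvalue_le_order_near_hub (R : realType) e v (k : nat) (a : R) : simple_graph e ->
  18 <= n -> (forall u v, u != v -> #|[set x | e u x && e v x]| <= 2) ->
  0 < k <= 2 -> #|[set x | e v x]| + k = n.-1 ->
  eigenvalue (signless_laplacian R e) a -> (a <= n%:R)%R.
Proof.
move=> sg n18 codeg k2 degv; have [sym irr] := sg.
apply: (eigenvalue_le_nat_supersolution R e (fun i => if i == v then n else 2)) => // i.
  by case: ifP => _ //; apply: leq_trans n18.
have degE u : #|e u| = #|[set x | e u x]| by rewrite cardsE.
have [->|iv] := eqVneq i v.
  (* The row of [v] is (n - 1 - k)(n + 2), which is at most n^2 because k >= 1. *)
  rewrite (eq_bigr (fun=> n + 2)); last first.
    by move=> j evj; case: eqP => // jv; rewrite jv irr in evj.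
  by rewrite sum_nat_const degE; nia.
(* Neighbours of [i] are [v], at most two common neighbours with [v], and some of the [k] vertices
   not adjacent to [v]. *)
have degi : #|[set x | e i x]| <= 3 + k.
  have sub : [set x | e i x] \subset
     [set v] :|: ([set x | e i x && e v x] :|: ~: (v |: [set x | e v x])).
    apply/subsetP => x; rewrite !inE => ->.
    by case: (x == v) => //=; case: (e v x).
  apply: leq_trans (subset_leq_card sub) _.
  apply: leq_trans (leq_card_setU _ _) _; rewrite cards1.
  have c2 := codeg i v iv.
  have : #|~: (v |: [set x | e v x])| = k.
    have := cardsC (v |: [set x | e v x]); rewrite card_ord cardsU1 inE irr.
    by move: degv n18; lia.
  move=> ck; rewrite -[3 + k]/(1 + (2 + k)) leq_add2l.
  by apply: leq_trans (leq_card_setU _ _) _; rewrite ck leq_add2r.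
have : \sum_(j | e i j) (2 + (if j == v then n else 2)) <=
       \sum_(j | e i j) 4 + \sum_(j | j == v) (n - 2).
  rewrite [\sum_(j | j == v) _]big_mkcond /=.
  rewrite [X in _ + X](bigID (e i)) /= addnA -big_split /=.
  apply: leq_trans (leq_addr _ _); apply: leq_sum => j _.
  by case: ifP => _; lia.
rewrite big_pred1_eq sum_nat_const degE /= => le1; apply: leq_trans le1 _.
(* As k <= 2 this is at most n + 18, hence at most 2n: the source of the bound 18. *)
apply: (@leq_trans ((3 + k) * 4 + (n - 2))).
  by rewrite leq_add2r leq_mul2r degi orbT.
by move: n18 k2; lia.
Qed.

End SmallMaximumDegree.

(** * The spectral radius of F_{2,3}(n) *)

Section ExtremalGraph.

Lemma count_block (N b : nat) : (\sum_(0 <= l < N) (l %/ 3 == b) = minn 3 (N - 3 * b))%N.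
Proof.
elim: N => [|N IH]; first by rewrite big_geq // sub0n minn0.
rewrite big_nat_recr //= IH; case: eqP => /=; lia.
Qed.

Lemma Fst23_ord0 (N : nat) (k : 'I_N) :
  (Fst 2 3 N.+1 ord0 (lift ord0 k) = true) * (Fst 2 3 N.+1 (lift ord0 k) ord0 = true).
Proof. by split; rewrite /Fst ?[lift _ _ == _]eq_sym neq_lift. Qed.

Lemma Fst23_lift (N : nat) (k l : 'I_N) :
  Fst 2 3 N.+1 (lift ord0 k) (lift ord0 l) = (k != l) && (k %/ 3 == l %/ 3)%N.
Proof. by rewrite /Fst (inj_eq lift_inj) /= /bump /= !add1n !subn1. Qed.

Lemma Fst_simple (s t n : nat) : simple_graph (Fst s t n).
Proof.
split=> [i j|i]; last by rewrite /Fst eqxx.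
by rewrite /Fst eq_sym orbCA [(_ %/ _ == _)%N]eq_sym.
Qed.

(** The hypothesis on [q] is the cubic in factored form: the hub row of the eigenvector, multiplied
    by q - 2r + 1. *)
Lemma q_radius_Fst23 (R : realType) (n : nat) (q : R) : (22 <= n)%N -> n%:R < q ->
  let r := ((n - 1) %% 3)%N in
  (q - 2 * r%:R + 1) * (q * (q - 5) - (n%:R - 1) * (q - 4)) + r%:R * (6 - 2 * r%:R) = 0 ->
  q_radius R (Fst 2 3 n) = q.
Proof.
case: n => // N n22 nq r; have {r}-> : r = (N %% 3)%N by rewrite /r subn1.
set r := (N %% 3)%N => qE.
have r2 : (r <= 2)%N by rewrite -ltnS ltn_mod.
have rR : r%:R <= 2 :> R by rewrite (ler_nat _ _ 2).
have r0 : 0 <= r%:R :> R by rewrite ler0n.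
have n22R : 22 <= N.+1%:R :> R by rewrite (ler_nat _ 22).
pose p := (N %/ 3)%N.
have NE : N = (3 * p + r)%N by rewrite mulnC -divn_eq.
clearbody p r.
have qr0 : 0 < q - 2 * r%:R + 1 by lra.
(* With weight q - 5 at the hub and 1 on triangles the triangle rows hold; the row of the remaining
   block, (y + q - 5) + 2(r - 1)y = q y, determines [y]. *)
pose y := (q - 5) / (q - 2 * r%:R + 1).
have yE : y * (q - 2 * r%:R + 1) = q - 5 by rewrite divfK // gt_eqF.
have y0 : 0 < y by rewrite divr_gt0 //; lra.
have hubE : N%:R * (q - 4) - r%:R + r%:R * y = q * (q - 5).
  have : (q - 2 * r%:R + 1) != 0 by rewrite gt_eqF.
  move/mulfI; apply; rewrite mulrDr [X in _ + X]mulrCA [_ * y]mulrC yE.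
  move: qE; rewrite -natr1; lra.
pose b (k : nat) : R := if (k < 3 * p)%N then 1 else y.
pose x (i : 'I_N.+1) : R := if unlift ord0 i is Some k then b k else q - 5.
have x0 : x ord0 = q - 5 by rewrite /x unlift_none.
have xS k : x (lift ord0 k) = b k by rewrite /x liftK.
have b0 k : 0 < b k by rewrite /b; case: ifP.
have sumb : \sum_(k < N) b k = 3 * p%:R + r%:R * y.
  rewrite -(big_mkord predT b) {1}NE (@big_cat_nat _ _ _ (3 * p)) ?leq_addr //=.
  congr (_ + _).
    rewrite (eq_big_nat _ _ (F2 := fun=> 1)); last by move=> k /andP [_ h]; rewrite /b h.
    by rewrite sumr_const_nat subn0 natrM.
  rewrite (eq_big_nat _ _ (F2 := fun=> y)); last first.
    by move=> k /andP [h _]; rewrite /b ltnNge h.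
  by rewrite sumr_const_nat addKn mulr_natl.
apply: (q_radius_eigenvector R N.+1 _ x) => //; first exact: Fst_simple.
- lra.
- by move=> i; case: (unliftP ord0 i) => [k|] ->; rewrite ?xS ?x0 //; lra.
move=> i; rewrite big_mkcond big_ord_recl.
case: (unliftP ord0 i) => [k|] -> {i}; last first.
  rewrite (Fst_simple 2 3 N.+1).2 /= add0r.
  under eq_bigr => k _ do rewrite x0 xS.
  rewrite big_split /= sumr_const card_ord sumb x0 -hubE.
  rewrite NE -mulr_natl natrD natrM; ring.
rewrite Fst23_ord0 x0 xS.
under eq_bigr => l _ do rewrite Fst23_lift xS.
rewrite [LHS]/=.
have kN := ltn_ord k.
have bE l : (k %/ 3 == l %/ 3)%N -> b l = b k.
  by rewrite /b => /eqP kl; congr (if _ then _ else _); lia.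
have cnt : ((\sum_(l < N) ((k != l) && (k %/ 3 == l %/ 3))).+1 = minn 3 (N - 3 * (k %/ 3)))%N.
  rewrite -count_block big_mkord [RHS](bigD1 k) //= eqxx add1n; congr _.+1.
  rewrite [RHS]big_mkcond; apply: eq_bigr => l _.
  by rewrite eq_sym [(l %/ 3 == _)%N]eq_sym; case: (l != k).
have -> : \sum_(l < N) (if (k != l) && (k %/ 3 == l %/ 3)%N then b k + b l else 0)
   = (\sum_(l < N) ((k != l) && (k %/ 3 == l %/ 3)%N))%:R * (2 * b k).
  rewrite natr_sum mulr_suml; apply: eq_bigr => l _.
  case: andP => [[_ /bE ->]|_]; rewrite ?mul0r ?mul1r //; ring.
rewrite /b; case: ltnP => kp.
  have -> : (\sum_(l < N) ((k != l) && (k %/ 3 == l %/ 3)) = 2)%N.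
    by apply/eqP; rewrite -eqSS cnt; clear -kp NE; move: (nat_of_ord k) kp => j kp; clear k; lia.
  ring.
have -> : (\sum_(l < N) ((k != l) && (k %/ 3 == l %/ 3)) = r.-1)%N.
  apply/eqP; rewrite -eqSS cnt; clear -kp kN NE r2.
  by move: (nat_of_ord k) kp kN => j kp kN; clear k; lia.
have rpos : (0 < r)%N.
  by clear -kp kN NE; move: (nat_of_ord k) kp kN => j kp kN; clear k; lia.
have -> : r.-1%:R = r%:R - 1 :> R by rewrite -subn1 natrB.
by rewrite -yE; ring.
Qed.

(** The factor q(q - 5) - (n - 1)(q - 4) is -4 at n and 2n - 8 at n + 2, and the last term is too
    small to spoil the sign change. *)
Lemma Fst23_root_exists (R : realType) (n : nat) (r : R) : (22 <= n)%N -> 0 <= r <= 2 ->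
  exists2 q : R, n%:R < q &
  (q - 2 * r + 1) * (q * (q - 5) - (n%:R - 1) * (q - 4)) + r * (6 - 2 * r) = 0.
Proof.
move=> n22 /andP [r0 r2].
have n22R : 22 <= n%:R :> R by rewrite (ler_nat _ 22).
set m : R := n%:R in n22R *.
pose P : {poly R} := ('X - (2 * r - 1)%:P) * ('X * ('X - 5%:P) - (m - 1)%:P * ('X - 4%:P))
   + (r * (6 - 2 * r))%:P.
have PE x : P.[x] = (x - 2 * r + 1) * (x * (x - 5) - (m - 1) * (x - 4)) + r * (6 - 2 * r).
  by rewrite /P !hornerE; ring.
have Pm : P.[m] < 0 by rewrite PE; nra.
have [||q /andP [mq qm] /rootP Pq] := @poly_ivt R P m (m + 2); first by lra.
  by rewrite (ltW Pm) PE; nra.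
exists q; last by rewrite -PE.
by rewrite lt_neqAle mq andbT; apply: contraTneq Pm => ->; rewrite Pq ltxx.
Qed.

End ExtremalGraph.

(* [4 / (q - 1)] and [2 / (q - 3)] are the costs of an isolated and of a pendant
   rim vertex; the extremal rim is the cheapest one with [n - 1] vertices. *)
Lemma rim_cost_ge (R : realType) (q T : R) (r A B : nat) : 22 <= q -> (r <= 2)%N ->
  T * (q - 2 * r%:R + 1) = r%:R * (6 - 2 * r%:R) ->
  ~~ odd B -> (B = 0%N -> r = A %% 3)%N ->
  T <= A%:R * (4 / (q - 1)) + B%:R * (2 / (q - 3)) /\
  (T = A%:R * (4 / (q - 1)) + B%:R * (2 / (q - 3)) -> (A + B = r /\ A <= 1)%N).
Proof.
move=> q22 r2 TE Beven AE.
pose a : R := 4 / (q - 1); pose b : R := 2 / (q - 3).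
have aE : a * (q - 1) = 4 by rewrite divfK // gt_eqF //; lra.
have bE : b * (q - 3) = 2 by rewrite divfK // gt_eqF //; lra.
rewrite -/a -/b.
have a0 : 0 < a by rewrite divr_gt0 //; lra.
have b0 : 0 < b by rewrite divr_gt0 //; lra.
(* A pair of pendant vertices costs more than one isolated vertex and less than two. *)
have ab : a < 2 * b by nra.
have ba : b < a by nra.
have AR : 0 <= A%:R * a by rewrite mulr_ge0 ?ler0n // ltW.
have BR : 0 <= B%:R * b by rewrite mulr_ge0 ?ler0n // ltW.
have Age k : (k <= A)%N -> k%:R * a <= A%:R * a by move=> h; rewrite ler_pM2r // ler_nat.
have Bge k : (k <= B)%N -> k%:R * b <= B%:R * b by move=> h; rewrite ler_pM2r // ler_nat.
(* These are the costs of the leftover block of F: empty, a single vertex, or an edge. *)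
have TV : T = match r with 0 => 0 | 1 => a | _ => 2 * b end.
  case: r r2 TE {AE} => [|[|[|]]] // _ TE.
  - have /eqP : T * (q + 1) = 0 by move: TE; lra.
    by rewrite mulf_eq0 => /orP [/eqP //|/eqP]; lra.
  - have q1 : q - 1 != 0 by rewrite gt_eqF //; lra.
    by apply: (mulIf q1); rewrite aE; move: TE; lra.
  - have q3 : q - 3 != 0 by rewrite gt_eqF //; lra.
    by apply: (mulIf q3); rewrite -mulrA bE; move: TE; lra.
have [B0|B2] : (B = 0 \/ 2 <= B)%N by move: Beven; case: (B) => [|[|]]; [left|by []|right].
  move: (AE B0) => rA; rewrite B0 mul0r addr0 addn0 TV.
  have [A0 [A1 A2]] : ((r = 0 -> A = 0 \/ 2 <= A) /\ (r = 1 -> A = 1 \/ 2 <= A) /\ (r = 2 -> 2 <= A))%N.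
    by move: rA; clear; lia.
  move: A0 A1 A2; case: r r2 {AE TE TV rA} => [|[|[|]]] // _ A0 A1 A2.
  - split=> // E; have [->|/Age] := A0 erefl; first by [].
    by move=> le2; exfalso; lra.
  - have [->|/Age] := A1 erefl; first by rewrite mul1r; split.
    by move=> le2; split; [lra|move=> E; exfalso; lra].
  - have /Age le2 := A2 erefl.
    by split; [lra|move=> E; exfalso; lra].
have le2 := Bge _ B2.
rewrite TV; case: r r2 {AE TE TV} => [|[|[|]]] // _.
- by split; [lra|move=> E; exfalso; lra].
- by split; [lra|move=> E; exfalso; lra].
split; first lra.
move=> E; have A0 : A = 0%N.
  by have [//|/Age] := posnP A; rewrite mul1r => le1; exfalso; lra.
split; last by rewrite A0.
have [B3|] := ltnP 2 B; last by rewrite A0; move: B2; clear; lia.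
by have le3 := Bge _ B3; exfalso; lra.
Qed.

(** * Graphs with a vertex of degree n - 1 *)

Section UniversalVertex.
Variables (n : nat) (e : rel 'I_n) (v : 'I_n).
Hypothesis sg : simple_graph e.
Hypothesis mf : minor_free e (Kst 2 3).
Hypothesis hub : forall x, x != v -> e v x.

Let g : rel 'I_n := rim_rel 'I_n e v.
Let h (u : 'I_n) : nat := #|[set y | g u y]|.
(** The hub has rim degree 0 as well and has to be excluded. *)
Let isolated : {set 'I_n} := [set u | (u != v) && (h u == 0)%N].
Let pendant : {set 'I_n} := [set u | h u == 1]%N.
Let inner : {set 'I_n} := [set u | h u == 2]%N.

Let gsym : symmetric g.
Proof.
by case: sg => sym _ x y; rewrite /g /rim_rel sym; case: (e y x); rewrite //= andbC.
Qed.

Let girr : irreflexive g.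
Proof. by case: sg => _ irr x; rewrite /g /rim_rel irr. Qed.

Let gv x : g x v = false.
Proof. by rewrite /g /rim_rel eqxx !andbF. Qed.

Let eg x y : x != v -> y != v -> e x y = g x y.
Proof. by rewrite /g /rim_rel => -> ->; rewrite !andbT. Qed.

Let hv : h v = 0%N.
Proof. by apply: eq_card0 => y; rewrite inE gsym gv. Qed.

Let h_le2 u : (h u <= 2)%N.
Proof.
have [->|uv] := eqVneq u v; first by rewrite hv.
apply: leq_trans (codegree_le2 _ e u v sg mf uv).
by apply/subset_leq_card/subsetP => y; rewrite !inE => /and3P [-> _ /hub ->].
Qed.

Let h_gt0 x y : g x y -> (0 < h y)%N.
Proof. by move=> gxy; apply/card_gt0P; exists x; rewrite inE gsym. Qed.

Let hub_card : n = (1 + #|isolated| + #|pendant| + #|inner|)%N.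
Proof.
rewrite -[LHS]card_ord -cardsT.
have -> : [set: 'I_n] = [set v] :|: isolated :|: pendant :|: inner.
  apply/setP => x; rewrite !inE; have [->|xv] //= := eqVneq x v.
  by move: (h_le2 x); case: (h x) => [|[|[]]].
rewrite !cardsU -[in RHS](cards1 v).
have -> : [set v] :&: isolated = set0.
  by apply/setP => x; rewrite !inE; case: eqP.
have -> : ([set v] :|: isolated) :&: pendant = set0.
  apply/setP => x; rewrite !inE; have [->|xv] //= := eqVneq x v; first by rewrite hv.
  by case: (h x) => [|[]].
have -> : ([set v] :|: isolated :|: pendant) :&: inner = set0.
  apply/setP => x; rewrite !inE; have [->|xv] //= := eqVneq x v; first by rewrite hv.
  by case: (h x) => [|[|[]]].
by rewrite cards0 !subn0.
Qed.

Let pendant_even : ~~ odd #|pendant|.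
Proof.
have := handshake _ g [set: 'I_n] gsym girr.
rewrite (eq_bigr h); last by move=> x _; apply: eq_card => y; rewrite !inE.
rewrite (eq_bigl predT); last by move=> x; rewrite inE.
have -> : (\sum_u h u = #|pendant| + #|inner|.*2)%N.
  rewrite -muln2 -sum_nat_const -[#|pendant|]sum1_card [X in _ = (X + _)%N]big_mkcond.
  rewrite [X in _ = (_ + X)%N]big_mkcond -big_split; apply: eq_bigr => u _ /=.
  by rewrite !inE; move: (h_le2 u); case: (h u) => [|[|[]]].
by rewrite oddD odd_double addbF.
Qed.

(** Closed under adjacency, [inner] is a union of cycles, which [rim_nbrs_adjacent] turns into
    triangles. *)
Let inner_listing : (forall x y, g x y -> x \in inner -> y \in inner) ->
  exists s : seq 'I_n, [/\ uniq s, s =i inner, (3 %| size s)%N &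
    forall x0 i j, (i < size s)%N -> (j < size s)%N ->
      g (nth x0 s i) (nth x0 s j) = (i != j) && (i %/ 3 == j %/ 3)%N].
Proof.
move=> clos; have h2 x : x \in inner -> h x = 2 by rewrite inE => /eqP.
apply: triangle_listing => //; first by move=> x y xi gxy; apply: clos gxy xi.
move=> x a b xi; apply: (rim_nbrs_adjacent _ e v inner) => // y z yi gyz.
exact: clos gyz yi.
Qed.

Lemma card_isolated_mod3 : #|pendant| = 0%N -> ((n - 1) %% 3 = #|isolated| %% 3)%N.
Proof.
move=> p0; have [s [us si s3 _]] : exists s : seq 'I_n, [/\ uniq s, s =i inner, (3 %| size s)%N &
    forall x0 i j, (i < size s)%N -> (j < size s)%N ->
      g (nth x0 s i) (nth x0 s j) = (i != j) && (i %/ 3 == j %/ 3)%N].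
  apply: inner_listing => x y gxy _; rewrite inE.
  have /card0_eq /(_ y) := p0; rewrite inE.
  by move: (h_gt0 _ _ gxy) (h_le2 y); case: (h y) => [|[|[]]].
have -> : (n - 1 = #|isolated| + size s)%N.
  apply/eqP; rewrite -(eqn_add2l 1) subnKC ?(leq_trans _ (ltn_ord v)) //.
  by rewrite addnA -(card_uniqP us) (eq_card si) {1}hub_card p0 addn0.
by rewrite -modnDmr (eqP s3) addn0.
Qed.

(** Listing [v], then the triangles, then the rest reproduces the vertex order of [Fst]. *)
Lemma Fst23_iso_of_hub : #|~: (v |: inner)| = ((n - 1) %% 3)%N ->
  (forall x y, g x y -> x \in inner -> y \in inner) ->
  (forall x y, x \notin v |: inner -> y \notin v |: inner -> x != y -> g x y) ->
  graph_iso e (Fst 2 3 n).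
Proof.
move=> cL clos clique.
have [s [us si s3 sP]] := inner_listing clos.
pose t : seq 'I_n := enum (~: (v |: inner)).
have vs : v \notin s by rewrite si inE hv.
have tP x : (x \in t) = (x \notin v |: inner) by rewrite mem_enum !inE.
have ut : uniq t := enum_uniq _.
pose l := v :: s ++ t.
have ul : uniq l.
  rewrite /= cat_uniq us ut mem_cat negb_or vs tP !inE eqxx /= andbT.
  by apply/hasPn => x; rewrite tP si !inE negb_or => /andP [].
have sl : size l = n.
  rewrite -[RHS]card_ord; apply/eqP; rewrite eqn_leq; apply/andP; split.
    by rewrite -(card_uniqP ul) max_card.
  rewrite cardE; apply: uniq_leq_size (enum_uniq _) _ => x _.
  rewrite inE mem_cat si tP 3!inE negb_or inE.
  by case: eqP => //= _; case: (h x == 2)%N.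
have st : size t = ((n - 1) %% 3)%N by rewrite -cL cardE.
clearbody t.
have st2 : (size t <= 2)%N by rewrite st -ltnS ltn_mod.
pose psi (i : 'I_n) := nth v l i.
have psi_inj : injective psi.
  move=> i j /eqP; rewrite nth_uniq ?sl // => /eqP; exact: ord_inj.
apply: graph_iso_sym; exists psi; split; first exact: injF_bij.
have [sym irr] := sg.
have body i : (i < size (s ++ t))%N -> nth v (s ++ t) i != v.
  move=> hi; have := mem_nth v hi; rewrite mem_cat; apply: contraTneq => ->.
  by rewrite (negbTE vs) tP !inE eqxx.
have main i j : (i < size (s ++ t))%N -> (j < size (s ++ t))%N ->
    g (nth v (s ++ t) i) (nth v (s ++ t) j) = (i != j) && (i %/ 3 == j %/ 3)%N.
  have mixed a b : (a < size s)%N -> ~~ (b < size s)%N -> (b < size (s ++ t))%N ->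
      g (nth v (s ++ t) a) (nth v (s ++ t) b) = (a != b) && (a %/ 3 == b %/ 3)%N.
    move=> ha hb hb'; rewrite !nth_cat ha (negbTE hb).
    (* As 3 divides [size s], no block meets both [s] and [t]. *)
    have -> : (a %/ 3 == b %/ 3)%N = false by move: hb s3; lia.
    rewrite andbF; apply/negP => /clos.
    rewrite -si mem_nth // => /(_ isT) bi.
    have : nth v t (b - size s) \in t.
      by apply: mem_nth; move: hb hb'; rewrite -leqNgt size_cat => hb hb'; rewrite ltn_subLR.
    by rewrite tP in_setU bi orbT.
  move=> hi hj; have [his|his] := boolP (i < size s)%N; have [hjs|hjs] := boolP (j < size s)%N.
  - by rewrite !nth_cat his hjs sP.
  - exact: mixed.
  - by rewrite gsym mixed // eq_sym [(j %/ 3 == _)%N]eq_sym.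
  - have -> : (i %/ 3 == j %/ 3)%N.
      by move: his hjs hi hj s3 st2; rewrite size_cat; move: (size s) (size t) => a b; clear; lia.
    rewrite andbT !nth_cat (negbTE his) (negbTE hjs).
    have [->|ij] := eqVneq i j; first by rewrite girr.
    have it : (i - size s < size t)%N by move: his hi; rewrite size_cat; move: (size s) (size t) => a b; clear; lia.
    have jt : (j - size s < size t)%N by move: hjs hj; rewrite size_cat; move: (size s) (size t) => a b; clear; lia.
    apply: clique; rewrite -?tP ?mem_nth // nth_uniq //.
    by move: his hjs ij; move: (size s) => a; clear; lia.
move=> i j; rewrite /Fst -val_eqE /= /psi.
have := ltn_ord i; have := ltn_ord j; rewrite -{2 4}sl /=.
case: (nat_of_ord i) => [|i']; case: (nat_of_ord j) => [|j'] //=; rewrite ?irr //.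
- by move=> hj _; rewrite hub // body.
- by move=> _ hi; rewrite sym hub // body.
move=> hj hi; rewrite eg ?body // main // !subn1 eqSS.
by [].
Qed.

Variables (R : realType) (q : R).
Hypothesis n22 : (22 <= n)%N.
Hypothesis nq : n%:R < q.

Let c (u : 'I_n) : nat := #|[set y | g u y && (y \in pendant)]|.
(** [alpha] makes the row of an isolated rim vertex tight, [tau] that of a pendant vertex whose
    neighbour has no loss; [beta] offsets, in the row of a vertex, the loss [tau] of a pendant
    neighbour. *)
Let alpha : R := 4 / (q - 1).
Let tau : R := 2 / (q - 2).
Let beta : R := tau / (q - 3).
(* [s u] is the loss of the weight of [u] relative to the weight 1 of the vertices
   of triangles; a pendant vertex induces the further loss [beta] at its
   neighbour, which makes the total cost of a pendant vertex [2 / (q - 3)]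
   whether its component is an edge or a longer path. *)
Let s (u : 'I_n) : R :=
  (h u == 0)%N%:R * alpha + (h u == 1)%N%:R * tau + (c u)%:R * beta.
Let x (u : 'I_n) : R := if u == v then q - 5 else 1 - s u.

Let q22 : 22 < q.
Proof. by apply: le_lt_trans nq; rewrite (ler_nat _ 22). Qed.

Let alphaE : alpha * (q - 1) = 4.
Proof. by rewrite divfK // gt_eqF //; move: q22; lra. Qed.

Let tauE : tau * (q - 2) = 2.
Proof. by rewrite divfK // gt_eqF //; move: q22; lra. Qed.

Let betaE : beta * (q - 3) = tau.
Proof. by rewrite divfK // gt_eqF //; move: q22; lra. Qed.

Let alpha_gt0 : 0 < alpha.
Proof. by rewrite divr_gt0 //; move: q22; lra. Qed.

Let tau_gt0 : 0 < tau.
Proof. by rewrite divr_gt0 //; move: q22; lra. Qed.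

Let beta_gt0 : 0 < beta.
Proof. by rewrite divr_gt0 //; move: q22; lra. Qed.

Let tau_betaE : tau + beta = 2 / (q - 3).
Proof.
have q3 : q - 3 != 0 by rewrite gt_eqF //; move: q22; lra.
apply: (mulIf q3); rewrite divfK // mulrDl betaE -tauE; ring.
Qed.

Let c_le_h u : (c u <= h u)%N.
Proof. by apply/subset_leq_card/subsetP => y; rewrite !inE => /andP []. Qed.

Let s_ge0 u : 0 <= s u.
Proof. by rewrite /s !addr_ge0 // mulr_ge0 ?ler0n // ltW. Qed.

Let s_lt1 u : s u < 1.
Proof.
have a1 : alpha < 1 by move: alphaE q22; nra.
have t1 : tau < 1 / 4 by move: tauE q22; nra.
have b1 : beta < 1 / 4 by move: betaE t1 q22 beta_gt0; nra.
have : (c u)%:R * beta <= (h u)%:R * beta by rewrite ler_pM2r // ler_nat.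
move: (h_le2 u) (c_le_h u); rewrite /s; case: (h u) => [|[|[|]]] //= _ cu le1;
  by move: le1 alpha_gt0 tau_gt0 beta_gt0 a1 t1 b1; lra.
Qed.

Let x_gt0 u : 0 < x u.
Proof. by rewrite /x; case: ifP => _; [move: q22; lra|rewrite subr_gt0]. Qed.

(** Only pendant neighbours are counted. If [u] is pendant too, it is itself a pendant neighbour of
    each of them, whence the extra [beta]. *)
Let nbr_s_ge u : (c u)%:R * (tau + (h u == 1)%N%:R * beta) <= \sum_(j | g u j) s j.
Proof.
rewrite (bigID [in pendant]) /= -[leLHS]addr0 lerD //; last by apply: sumr_ge0.
have -> : (c u)%:R * (tau + (h u == 1)%N%:R * beta) =
    \sum_(j | g u j && (j \in pendant)) (tau + (h u == 1)%N%:R * beta).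
  by rewrite sumr_const mulr_natl /c cardsE.
apply: ler_sum => j /andP [guj jp]; have hj : h j = 1%N by move: jp; rewrite inE => /eqP.
rewrite /s hj /= mul0r mul1r add0r lerD2l ler_pM2r // ler_nat.
case: eqP => //= hu; apply/card_gt0P; exists u.
by rewrite !inE gsym guj hu.
Qed.

Let nbrE u : u != v -> forall F : 'I_n -> R,
  \sum_(j | e u j) F j = F v + \sum_(j | g u j) F j.
Proof.
move=> uv F; have [sym _] := sg; rewrite (bigD1 v) /=; last by rewrite sym hub.
congr (_ + _); apply: eq_bigl => j.
by rewrite /g /rim_rel uv.
Qed.

(** Without losses the slack is 4 - 2h, so the hub weight q - 5 makes triangle rows tight. *)
Let rim_row u : u != v ->
  q * x u - \sum_(j | e u j) (x u + x j) =
  4 - 2 * (h u)%:R + \sum_(j | g u j) s j - (q - 1 - (h u)%:R) * s u.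
Proof.
move=> uv; rewrite nbrE //.
have -> : \sum_(j | g u j) (x u + x j) = (h u)%:R * (x u + 1) - \sum_(j | g u j) s j.
  rewrite mulr_natl {1}/h cardsE -sumr_const -sumrB; apply: eq_bigr => j guj.
  have jv : j != v by case/and3P: guj.
  by rewrite [x j]/x (negbTE jv); ring.
rewrite /x eqxx (negbTE uv); ring.
Qed.

Let rim_row_ge0 u : u != v -> \sum_(j | e u j) (x u + x j) <= q * x u.
Proof.
move=> uv; rewrite -subr_ge0 rim_row //.
have := nbr_s_ge u; have := c_le_h u; rewrite [s u]/s.
set Z := \sum_(j | g u j) s j; move: (h_le2 u); case: (h u) => [|[|[|]]] //= _ cu.
- have -> : c u = 0%N by apply/eqP; rewrite -leqn0.
  by move: alphaE; lra.
- have : (q - 1 - 1) * (tau + (c u)%:R * beta) = 2 + (c u)%:R * (tau + beta).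
    have -> : q - 1 - 1 = q - 2 by ring.
    by rewrite mulrDr [_ * tau]mulrC tauE -betaE; ring.
  lra.
- have : (q - 1 - 2) * ((c u)%:R * beta) = (c u)%:R * tau by rewrite -betaE; ring.
  lra.
Qed.

(** The slack is at least [beta], the loss induced at [w]. In the case of equality this excludes rim
    paths with more than one edge. *)
Let rim_row_gt0 u w : h u = 1%N -> g u w -> h w = 2%N ->
  \sum_(j | e u j) (x u + x j) != q * x u.
Proof.
move=> hu guw hw; have uv : u != v by case/and3P: guw.
rewrite eq_sym -subr_eq0 rim_row // hu gt_eqF //.
have Nu : [set y | g u y] = [set w].
  by apply/esym/eqP; rewrite eqEcard cards1 -/(h u) hu leqnn andbT sub1set inE.
have cu : c u = 0%N.
  apply: eq_card0 => y; rewrite !inE; apply/negP => /andP [guy].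
  have : y \in [set y | g u y] by rewrite inE.
  by rewrite Nu inE => /eqP ->; rewrite hw.
have sw : beta <= \sum_(j | g u j) s j.
  rewrite (bigD1 w) //= -[leLHS]addr0 lerD ?sumr_ge0 //.
  rewrite /s hw /= !mul0r !add0r -[leLHS]mul1r ler_pM2r // ler1n.
  by apply/card_gt0P; exists u; rewrite !inE gsym guw hu.
rewrite /s hu cu /= !mul0r mul1r add0r addr0.
by move: sw tauE beta_gt0; lra.
Qed.

(** Each pendant vertex has exactly one rim neighbour, so it contributes [tau] and one [beta]. *)
Let sum_s : \sum_(j | j != v) s j =
  #|isolated|%:R * (4 / (q - 1)) + #|pendant|%:R * (2 / (q - 3)).
Proof.
have cv : c v = 0%N by apply/eqP; rewrite -leqn0 -hv c_le_h.
have sumc : (\sum_(j | j != v) c j = #|pendant|)%N.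
  transitivity (\sum_j c j)%N; first by rewrite [RHS](bigD1 v) //= cv add0n.
  rewrite (eq_bigr (fun j => (\sum_(k in pendant) g j k)%N)); last first.
    move=> j _; rewrite /c -sum1_card big_mkcond [RHS]big_mkcond; apply: eq_bigr => k _.
    by rewrite in_set; case: (g j k); case: (k \in pendant).
  rewrite exchange_big /= -sum1_card; apply: eq_bigr => k.
  rewrite inE => /eqP hk; transitivity (h k) => //.
  rewrite /h -sum1_card [RHS]big_mkcond; apply: eq_bigr => j _.
  by rewrite inE gsym; case: (g k j).
rewrite /s !big_split /= -!mulr_suml -!natr_sum sumc -tau_betaE mulrDr -addrA.
congr (_ * _ + (_ * _ + _)); congr _%:R.
  rewrite -sum1_card big_mkcond [RHS]big_mkcond; apply: eq_bigr => j _.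
  by rewrite inE; case: (j != v); case: (h j).
rewrite -sum1_card big_mkcond [RHS]big_mkcond; apply: eq_bigr => j _.
rewrite inE; have [->|] := eqVneq j v; first by rewrite hv.
by case: (h j == 1%N).
Qed.

Let hub_row : \sum_(j | e v j) (x v + x j) =
  (n%:R - 1) * (q - 4) - (#|isolated|%:R * (4 / (q - 1)) + #|pendant|%:R * (2 / (q - 3))).
Proof.
have [_ irr] := sg.
rewrite (eq_bigl (fun j => j != v)); last first.
  by move=> j; have [->|/hub ->] := eqVneq j v; rewrite ?irr.
rewrite (eq_bigr (fun j => (q - 4) - s j)); last first.
  by move=> j /negbTE jv; rewrite /x eqxx jv; ring.
rewrite sumrB sumr_const cardC1 card_ord sum_s -[(q - 4) *+ _]mulr_natl -subn1 natrB //.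
exact: leq_trans n22.
Qed.

Let r := ((n - 1) %% 3)%N.
Hypothesis qE : (q - 2 * r%:R + 1) * (q * (q - 5) - (n%:R - 1) * (q - 4))
  + r%:R * (6 - 2 * r%:R) = 0.

(** The total loss that makes the hub row tight; [qE] identifies it with the [T] of
    [rim_cost_ge]. *)
Let T : R := (n%:R - 1) * (q - 4) - q * (q - 5).

Let cost_ge :
  let cost := #|isolated|%:R * (4 / (q - 1)) + #|pendant|%:R * (2 / (q - 3)) in
  T <= cost /\ (T = cost -> (#|isolated| + #|pendant| = r /\ #|isolated| <= 1)%N).
Proof.
apply: rim_cost_ge (ltW q22) _ _ pendant_even card_isolated_mod3.
  by rewrite -ltnS ltn_mod.
by move: qE; rewrite /T; lra.
Qed.

Let supersolution u : \sum_(j | e u j) (x u + x j) <= q * x u.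
Proof.
have [->|uv] := eqVneq u v; last exact: rim_row_ge0.
rewrite hub_row [x v]/x eqxx; have [] := cost_ge; rewrite /T; lra.
Qed.

Lemma eigenvalue_le_hub a : eigenvalue (signless_laplacian R e) a -> a <= q.
Proof. exact: (eigenvalue_le_supersolution R n e x). Qed.

Lemma graph_iso_Fst23_of_eigenvalue :
  eigenvalue (signless_laplacian R e) q -> graph_iso e (Fst 2 3 n).
Proof.
move=> /(eigenvalue_supersolution_eq R n e x q v sg hub x_gt0 supersolution) rowE.
have [AB A1] : (#|isolated| + #|pendant| = r)%N /\ (#|isolated| <= 1)%N.
  apply: (proj2 cost_ge).
  by have := rowE v; rewrite hub_row [x v]/x eqxx /T; lra.
have clos y z : g y z -> y \in inner -> z \in inner.
  move=> gyz; rewrite !inE => /eqP hy.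
  move: (h_gt0 _ _ gyz) (h_le2 z); case hz: (h z) => [|[|[|]]] // _ _.
  by have := rim_row_gt0 z y hz; rewrite gsym gyz hy rowE eqxx => /(_ isT erefl).
have LE : ~: (v |: inner) = isolated :|: pendant.
  apply/setP => y; rewrite !inE; have [->|yv] /= := eqVneq y v; first by rewrite hv.
  by move: (h_le2 y); case: (h y) => [|[|[]]].
have dis : isolated :&: pendant = set0.
  by apply/setP => y; rewrite !inE; case: (h y) => [|[|k]] //=; rewrite ?andbF.
have cL : #|~: (v |: inner)| = r by rewrite LE cardsU dis cards0 subn0.
apply: Fst23_iso_of_hub => // y z; rewrite -![_ \notin _]in_setC => yL zL yz.
(* Two distinct leftover vertices force r = 2; at most one is isolated and the number of pendant
   ones is even, so both are pendant. *)
have rge : (2 <= r)%N.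
  apply: (@leq_trans #|[set y; z]|); first by rewrite cards2 yz.
  rewrite -cL; apply: subset_leq_card; apply/subsetP => w.
  by rewrite in_set2 => /orP [] /eqP ->.
have r2 : (r <= 2)%N by rewrite -ltnS ltn_mod.
have p2 : (#|pendant| = 2 /\ #|isolated| = 0)%N.
  by move: AB A1 pendant_even rge r2; clear; lia.
have /cards0_eq iso0 := p2.2; move: yL zL; rewrite LE iso0 set0U => yp zp.
have pE : [set y; z] = pendant.
  apply/eqP; rewrite eqEcard cards2 yz p2.1 leqnn andbT.
  by apply/subsetP => w; rewrite !inE => /orP [] /eqP ->; [move: yp|move: zp]; rewrite inE.
have hy : h y = 1%N by move: yp; rewrite inE => /eqP.
have /card_gt0P [w] : (0 < h y)%N by rewrite hy.
rewrite inE => gyw.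
(* A neighbour in [inner] would put [y] there by closure, so the neighbour of [y] must be [z]. *)
have wp : w \in pendant.
  rewrite inE; move: (h_gt0 _ _ gyw) (h_le2 w); case hw: (h w) => [|[|[|]]] // _ _.
  have : y \in inner by apply: (clos w); rewrite ?inE ?hw // gsym.
  by rewrite inE hy.
move: wp; rewrite -pE !inE => /orP [] /eqP wE; last by rewrite -wE.
by rewrite wE girr in gyw.
Qed.

End UniversalVertex.

Theorem theorem1p2 (R : realType) (n : nat) (e : rel 'I_n) :
  simple_graph e -> (22 <= n)%N -> minor_free e (Kst 2%N 3%N) ->
  let r := ((n - 1) %% 3)%N in
  let cubic := fun x : R =>
    x ^+ 3 - (n%:R + 2 * r%:R + 3) * x ^+ 2
    + (8 * r%:R + 3 * n%:R + 2 * r%:R * n%:R - 8) * x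
    + (14 * r%:R + 4 * n%:R - 8 * r%:R * n%:R - 2 * r%:R ^+ 2 - 4) in
  [/\ q_radius R e <= q_radius R (Fst 2%N 3%N n),
      q_radius R e = q_radius R (Fst 2%N 3%N n) <-> graph_iso e (Fst 2%N 3%N n),
      cubic (q_radius R (Fst 2%N 3%N n)) = 0 &
      forall x : R, cubic x = 0 -> x <= q_radius R (Fst 2%N 3%N n)].
Proof.
move=> sg n22 mf r cubic.
have [sym irr] := sg.
have cubicE x : cubic x =
    (x - 2 * r%:R + 1) * (x * (x - 5) - (n%:R - 1) * (x - 4)) + r%:R * (6 - 2 * r%:R).
  by rewrite /cubic; ring.
have r2 : (r <= 2)%N by rewrite -ltnS ltn_mod.
have [|q nq qE] := Fst23_root_exists R n r%:R n22.
  by rewrite ler0n (ler_nat _ _ 2).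
have FE x : n%:R < x -> cubic x = 0 -> q_radius R (Fst 2 3 n) = x.
  by move=> nx; rewrite cubicE; apply: q_radius_Fst23.
have Fq : q_radius R (Fst 2 3 n) = q by apply: FE; rewrite ?cubicE.
have q0 : 0 < q by apply: le_lt_trans nq; rewrite ler0n.
suff [le_q eq_q] : q_radius R e <= q /\ (q_radius R e = q -> graph_iso e (Fst 2 3 n)).
  split; rewrite ?Fq //; last 2 first.
  - by rewrite cubicE.
  (* [FE] applies to every root above n, so all such roots equal q(F). *)
  - move=> x x0; have [/le_trans|nx] := leP x n%:R; first by apply; exact: ltW.
    by rewrite -(FE x) // Fq.
  by split=> // /(q_radius_graph_iso R) ->.
have codeg (u w : 'I_n) : u != w -> (#|[set x | e u x && e w x]| <= 2)%N.
  exact: codegree_le2.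
(* A radius at most n < q makes equality impossible. *)
have small : (forall a, eigenvalue (signless_laplacian R e) a -> a <= n%:R) ->
    q_radius R e <= q /\ (q_radius R e = q -> graph_iso e (Fst 2 3 n)).
  move=> /(q_radius_le R n e n%:R (ler0n _ _)) len.
  split; first exact: le_trans len (ltW nq).
  by move=> eq_q; move: nq; rewrite -eq_q ltNge len.
have degN (u : 'I_n) : (#|[set x | e u x]| <= n.-1)%N.
  rewrite -[n in n.-1]card_ord -(cardsC1 u); apply/subset_leq_card/subsetP => x.
  by rewrite !inE; apply: contraTneq => ->; rewrite irr.
have [/existsP [v /eqP vdeg]|nohub] := boolP [exists v, #|[set x | e v x]| == n.-1].
  have hub (x : 'I_n) : x != v -> e v x.
    move=> xv; have : x \in [set~ v] by rewrite !inE.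
    suff <- : [set x | e v x] = [set~ v] by rewrite inE.
    apply/eqP; rewrite eqEcard cardsC1 card_ord vdeg leqnn andbT.
    by apply/subsetP => y; rewrite !inE; apply: contraTneq => ->; rewrite irr.
  have ub := eigenvalue_le_hub n e v sg mf hub R q n22 nq qE.
  split; first by apply: q_radius_le ub; exact: ltW.
  move=> eq_q; apply: (graph_iso_Fst23_of_eigenvalue n e v sg mf hub R q n22 nq qE).
  by rewrite -eq_q; apply: q_radius_eigenvalue ub _; rewrite eq_q gt_eqF.
apply: small.
have [/existsP [v vdeg]|sparse] := boolP [exists v, n - 3 <= #|[set x | e v x]|]%N; last first.
  move=> a; apply: eigenvalue_le_order_sparse => //; first by apply: leq_trans n22.
  move=> u; move: sparse; rewrite negb_exists => /forallP /(_ u).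
  by rewrite -ltnNge; move: n22 (#|_|); clear; lia.
have vne : #|[set x | e v x]| != n.-1.
  by move: nohub; rewrite negb_exists => /forallP /(_ v).
move=> a; apply: (eigenvalue_le_order_near_hub n R e v (n.-1 - #|[set x | e v x]|)) => //.
- exact: leq_trans n22.
- by move: (degN v) vdeg vne n22; move: (#|_|) => d; clear; lia.
- by rewrite subnKC.
Qed.
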